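(* Let $m\leqslant n$, let $A\in\mathbb{R}^{n\times n}$ be nonsymmetric positive definite and let $B\in\mathbb{R}^{m\times n}$ be rank-deficient. Let $H\in\mathbb{R}^{n\times n}$ and $Q\in\mathbb{R}^{m\times m}$ be symmetric positive definite matrices. Then $$\mathrm{rank}(I-\Gamma)=\mathrm{rank}\big((I-\Gamma)^2\big),$$ where $\Gamma=\mathcal{M}^{-1}\mathcal{N}$ is the iteration matrix of the MGSS method.
   Context: A (nonsymmetric) matrix $A\in\mathbb{R}^{n\times n}$ is called positive definite if $x^TAx>0$ for all $0\neq x\in\mathbb{R}^n$ (''nonsymmetric'' means symmetry is not assumed). ''$B$ is rank-deficient'' means $\mathrm{rank}(B)<m\leqslant n$. Define the block matrices $$\mathcal{A}=\begin{pmatrix}A & B^T\\ -B & 0\end{pmatrix},\quad \Omega=\begin{pmatrix}H&0\\0&Q\end{pmatrix},\quad \mathcal{M}=\tfrac12(\Omega+\mathcal{A}),\quad \mathcal{N}=\tfrac12(\Omega-\mathcal{A}),$$ so that $\mathcal{A}=\mathcal{M}-\mathcal{N}$; the matrix $\mathcal{M}$ is nonsingular. The MGSS (modified generalized shift-splitting) method for $\mathcal{A}u=b$ is the iteration $\mathcal{M}u^{(k+1)}=\mathcal{N}u^{(k)}+b$. $I$ is the identity matrix of order $n+m$. *)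

(* Defs.v *)
From mathcomp Require Import all_boot all_order all_algebra.
From mathcomp Require Import reals.

Set Implicit Arguments.
Unset Strict Implicit.
Unset Printing Implicit Defensive.

Import Order.TTheory GRing.Theory Num.Theory.
Local Open Scope ring_scope.

(* Symmetry is not part of positive definiteness. *)
Definition posdefmx (R : realType) (n : nat) (A : 'M[R]_n) : Prop :=
  forall x : 'cV[R]_n, x != 0 -> 0 < (x^T *m A *m x) 0 0.

Definition saddle_mx (R : realType) (n m : nat)
    (A : 'M[R]_n) (B : 'M[R]_(m, n)) : 'M[R]_(n + m) :=
  block_mx A B^T (- B) 0.

Definition shift_mx (R : realType) (n m : nat)
    (H : 'M[R]_n) (Q : 'M[R]_m) : 'M[R]_(n + m) :=
  block_mx H 0 0 Q.

Definition mgss_M (R : realType) (n m : nat) (A : 'M[R]_n) (B : 'M[R]_(m, n))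
    (H : 'M[R]_n) (Q : 'M[R]_m) : 'M[R]_(n + m) :=
  2^-1 *: (shift_mx H Q + saddle_mx A B).

Definition mgss_N (R : realType) (n m : nat) (A : 'M[R]_n) (B : 'M[R]_(m, n))
    (H : 'M[R]_n) (Q : 'M[R]_m) : 'M[R]_(n + m) :=
  2^-1 *: (shift_mx H Q - saddle_mx A B).

(* The iteration M u_(k+1) = N u_k + b reads u_(k+1) = M^-1 N u_k + M^-1 b.
   invmx is the identity on singular matrices; mgss_M_unit below shows that
   this default value is never reached here. *)
Definition mgss_iter (R : realType) (n m : nat) (A : 'M[R]_n)
    (B : 'M[R]_(m, n)) (H : 'M[R]_n) (Q : 'M[R]_m) : 'M[R]_(n + m) :=
  invmx (mgss_M A B H Q) *m mgss_N A B H Q.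

Lemma posdefmx_unit (R : realType) (n : nat) (A : 'M[R]_n) :
  posdefmx A -> A \in unitmx.
Proof.
move=> pA; rewrite -unitmx_tr -row_free_unit -kermx_eq0.
apply/eqP/row_matrixP => i; rewrite row0.
apply/eqP/contraT => ri_neq0.
have rA : row i (kermx A^T) *m A^T = 0.
  by apply/sub_kermxP; rewrite row_sub.
have := pA (row i (kermx A^T))^T; rewrite trmx_eq0 => /(_ ri_neq0).
have /(congr1 trmx) := rA; rewrite trmx_mul trmxK trmx0 => Ar.
by rewrite -mulmxA Ar mulmx0 mxE ltxx.
Qed.

Lemma mgss_M_posdef (R : realType) (n m : nat) (A : 'M[R]_n)
    (B : 'M[R]_(m, n)) (H : 'M[R]_n) (Q : 'M[R]_m) :
  posdefmx A -> posdefmx H -> posdefmx Q -> posdefmx (mgss_M A B H Q).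
Proof.
move=> pA pH pQ x; rewrite -[x]vsubmxK.
move: (usubmx x) (dsubmx x) => y z yz_neq0.
have -> : ((col_mx y z)^T *m mgss_M A B H Q *m col_mx y z) 0 0 =
    2^-1 * ((y^T *m H *m y) 0 0 + (y^T *m A *m y) 0 0 + (z^T *m Q *m z) 0 0).
  rewrite /mgss_M -scalemxAr -scalemxAl mxE; congr (_ * _).
  rewrite /shift_mx /saddle_mx add_block_mx !add0r addr0 tr_col_mx.
  rewrite mul_row_block mul_row_col !mulmxDl !mulmxDr !mulmxDl mulmxN mulNmx.
  have -> : y^T *m B^T *m z = z^T *m B *m y.
    have <- : (z^T *m B *m y)^T = y^T *m B^T *m z.
      by rewrite !trmx_mul trmxK mulmxA.
    by rewrite [LHS]mx11_scalar mxE -mx11_scalar.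
  by rewrite addrA subrK !mxE.
rewrite mulr_gt0 ?invr_gt0 ?ltr0n //.
have nn k (C : 'M[R]_k) (v : 'cV_k) : posdefmx C -> 0 <= (v^T *m C *m v) 0 0.
  move=> pC; have [->|/pC/ltW//] := eqVneq v 0.
  by rewrite mulmx0 mxE.
have [y0|y_neq0] := eqVneq y 0.
  have z_neq0 : z != 0.
    by apply: contra_neq yz_neq0 => ->; rewrite y0 col_mx0.
  by rewrite ltr_wpDl ?pQ // addr_ge0 ?nn.
by rewrite ltr_pwDl ?nn // ltr_pwDl ?nn ?pH.
Qed.

Lemma mgss_M_unit (R : realType) (n m : nat) (A : 'M[R]_n)
    (B : 'M[R]_(m, n)) (H : 'M[R]_n) (Q : 'M[R]_m) :
  posdefmx A -> posdefmx H -> posdefmx Q -> mgss_M A B H Q \in unitmx.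
Proof. by move=> pA pH pQ; exact/posdefmx_unit/mgss_M_posdef. Qed.

(* Main.v *)
(* Write K for the saddle matrix and M for the preconditioner, so that I - Gamma = M^-1 K.
   A vector w with K w = 0 has the form (0, z) with B^T z = 0, hence also w^T K = 0.
   If (M^-1 K)^2 u = 0, then w = M^-1 K u lies in the kernel of K, so
   w^T M w = w^T K u = 0 and w = 0 because M is positive definite. *)
Require Import Defs.
From mathcomp Require Import all_boot all_order all_algebra.
From mathcomp Require Import reals.

Set Implicit Arguments.
Unset Strict Implicit.
Unset Printing Implicit Defensive.

Import Order.TTheory GRing.Theory Num.Theory.
Local Open Scope ring_scope.

(** By [mxrank_mul_ker], the rank lost in squaring is the dimension of image meet kernel, which
    [kerT] makes zero. Transposes are needed because [kermx] and row spaces act on row vectors. *)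
Lemma mxrank_mulmx_self (F : fieldType) (n : nat) (T : 'M[F]_n) :
  (forall u : 'cV_n, T *m (T *m u) = 0 -> T *m u = 0) ->
  \rank (T *m T) = \rank T.
Proof.
move=> kerT; rewrite -mxrank_tr trmx_mul -[RHS]mxrank_tr.
rewrite -[RHS](mxrank_mul_ker _ T^T).
suff -> : (T^T :&: kermx T^T)%MS = 0 by rewrite mxrank0 addn0.
apply/row_matrixP => i; rewrite row0.
have := row_sub i (T^T :&: kermx T^T)%MS.
(* A row of the intersection is [d *m T^T] with [d *m T^T *m T^T = 0]; transposing, [kerT] applies
   to [u = d^T]. *)
rewrite sub_capmx => /andP[/submxP[d ->] /sub_kermxP dTT].
apply: trmx_inj; rewrite trmx0 trmx_mul trmxK kerT //.
by apply: trmx_inj; rewrite !trmx_mul !trmxK trmx0.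
Qed.

Lemma posdefmx_eq0 (R : realType) (n : nat) (A : 'M[R]_n) (x : 'cV_n) :
  posdefmx A -> x^T *m A *m x = 0 -> x = 0.
Proof.
move=> pA xAx; apply/eqP/contraT => /pA.
by rewrite xAx mxE ltxx.
Qed.

Lemma mxrank_invmx_posdef_mul (R : realType) (n : nat) (M K : 'M[R]_n) :
  posdefmx M -> (forall w : 'cV_n, K *m w = 0 -> w^T *m K = 0) ->
  \rank (invmx M *m K *m (invmx M *m K)) = \rank (invmx M *m K).
Proof.
move=> pM kerK; have uM := posdefmx_unit pM.
apply: mxrank_mulmx_self => u; set w := _ *m u => MKw.
have Kw : K *m w = 0 by rewrite -[K](mulKVmx uM) -mulmxA MKw mulmx0.
apply: (posdefmx_eq0 pM).
have Mw : M *m w = K *m u by rewrite /w -mulmxA mulKVmx.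
by rewrite -mulmxA Mw mulmxA kerK // mul0mx.
Qed.

Lemma saddle_mx_kerl (R : realType) (n m : nat) (A : 'M[R]_n)
    (B : 'M[R]_(m, n)) (w : 'cV_(n + m)) :
  posdefmx A -> saddle_mx A B *m w = 0 -> w^T *m saddle_mx A B = 0.
Proof.
move=> pA; rewrite -[w]vsubmxK; move: (usubmx w) (dsubmx w) => y z.
rewrite mul_block_col mul0mx addr0 -[0]col_mx0 mulNmx.
move=> /eq_col_mx[AyBz /eqP]; rewrite oppr_eq0 => /eqP By.
(* Since [A *m y = - (B^T *m z)], the form [y^T *m A *m y] equals [- ((B *m y)^T *m z)], which
   vanishes. *)
have y0 : y = 0.
  apply: (posdefmx_eq0 pA).
  rewrite -mulmxA -[A *m y](addrK (B^T *m z)) AyBz sub0r mulmxN mulmxA.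
  by rewrite -trmx_mul By trmx0 mul0mx oppr0.
move: AyBz; rewrite y0 mulmx0 add0r => Bz.
rewrite tr_col_mx trmx0 mul_row_block !mul0mx !add0r mulmx0 mulmxN.
by rewrite -[B]trmxK -trmx_mul Bz trmx0 oppr0 row_mx0.
Qed.

Lemma mgss_M_subN (R : realType) (n m : nat) (A : 'M[R]_n)
    (B : 'M[R]_(m, n)) (H : 'M[R]_n) (Q : 'M[R]_m) :
  mgss_M A B H Q - mgss_N A B H Q = saddle_mx A B.
Proof.
rewrite -scalerBr opprB addrC addrA subrK -mulr2n -scaler_nat scalerA.
by rewrite mulVf ?pnatr_eq0 // scale1r.
Qed.

Theorem theorem2 (R : realType) (n m : nat) (hmn : (m <= n)%N)
    (A : 'M[R]_n) (hA : posdefmx A)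
    (B : 'M[R]_(m, n)) (hB : (\rank B < m)%N)
    (H : 'M[R]_n) (symH : H^T = H) (hH : posdefmx H)
    (Q : 'M[R]_m) (symQ : Q^T = Q) (hQ : posdefmx Q) :
  \rank (1%:M - mgss_iter A B H Q) = \rank ((1%:M - mgss_iter A B H Q) ^+ 2).
Proof.
have pM := mgss_M_posdef B hA hH hQ.
have -> : 1%:M - mgss_iter A B H Q = invmx (mgss_M A B H Q) *m saddle_mx A B.
  by rewrite -(mgss_M_subN A B H Q) mulmxBr mulVmx // posdefmx_unit.
(* The ring product of square matrices is [*m] by conversion. *)
rewrite expr2 -[_ * _]/(_ *m _) mxrank_invmx_posdef_mul // => w.
exact: saddle_mx_kerl.
Qed.
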